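(* For all integers $n\ge2$, $$2n+2<S_{n,0}<2n+2+\frac1{2n-2},$$ and for all integers $n\ge2$, $k\ge1$, $$\frac{P_{2k+4}}{P_{2k+2}}<S_{n,k}<S_{n+1,k}<\frac{P_{2k+2}}{P_{2k}}.$$
   Context: Pell numbers $P_m$ and half-companion Pell numbers $H_m$: $P_0=0,P_1=1$, $H_0=H_1=1$, $P_{m+2}=2P_{m+1}+P_m$, $H_{m+2}=2H_{m+1}+H_m$; also $P_{-1}=1$, $H_{-1}=-1$. For integers $n\ge2,k\ge0$, $$S_{n,k}=\frac{(\sqrt{n^2-1}+1)P_{2k+1}+nH_{2k+1}}{(\sqrt{n^2-1}+1)P_{2k-1}+nH_{2k-1}}.$$ *)

(* Defs.v *)
From Stdlib Require Import ZArith Reals Lia.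

Open Scope Z_scope.

(** Pell numbers P_m and half-companion Pell numbers H_m are indexed by all
    m : Z, because S_{n,0} involves P_{-1} and H_{-1}.  For m >= 0 they are
    computed from the initial values at 0 and 1; for m < 0 the same recurrence
    is run backwards, x_m = x_{m+2} - 2 x_{m+1}. *)

Fixpoint rec_up (a b : Z) (m : nat) : Z :=
  match m with
  | O => a
  | S m' => rec_up b (2 * b + a) m'
  end.

Fixpoint rec_down (a b : Z) (m : nat) : Z :=
  match m with
  | O => a
  | S m' => rec_down (b - 2 * a) a m'
  end.

(** The bi-infinite solution of x_{m+2} = 2 x_{m+1} + x_m with x_0 = a, x_1 = b. *)
Definition rec_seq (a b m : Z) : Z :=
  if m <? 0 then rec_down a b (Z.to_nat (- m)) else rec_up a b (Z.to_nat m).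

Definition pell (m : Z) : Z := rec_seq 0 1 m.
Definition hpell (m : Z) : Z := rec_seq 1 1 m.

Lemma rec_up_step a b m :
  rec_up a b (S (S m)) = 2 * rec_up a b (S m) + rec_up a b m.
Proof.
  revert a b; induction m as [|m IH]; intros a b; [reflexivity|exact (IH b (2 * b + a))].
Qed.

Lemma rec_down_step a b m :
  rec_down a b m = 2 * rec_down a b (S m) + rec_down a b (S (S m)).
Proof.
  revert a b; induction m as [|m IH]; intros a b; [simpl; lia|exact (IH (b - 2 * a) a)].
Qed.

Lemma rec_seq_step a b m :
  rec_seq a b (m + 2) = 2 * rec_seq a b (m + 1) + rec_seq a b m.
Proof.
  unfold rec_seq.
  destruct (Z.le_gt_cases 0 m) as [Hm|Hm].
  - rewrite !(proj2 (Z.ltb_ge _ _)) by lia.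
    replace (Z.to_nat (m + 2)) with (S (S (Z.to_nat m))) by lia.
    replace (Z.to_nat (m + 1)) with (S (Z.to_nat m)) by lia.
    apply rec_up_step.
  - destruct (Z.eq_dec m (-1)) as [->|H1]; [simpl; lia|].
    destruct (Z.eq_dec m (-2)) as [->|H2]; [simpl; lia|].
    rewrite !(proj2 (Z.ltb_lt _ _)) by lia.
    replace (Z.to_nat (- m)) with (S (S (Z.to_nat (- (m + 2))))) by lia.
    replace (Z.to_nat (- (m + 1))) with (S (Z.to_nat (- (m + 2)))) by lia.
    apply rec_down_step.
Qed.

Lemma pell_step m : pell (m + 2) = 2 * pell (m + 1) + pell m.
Proof. apply rec_seq_step. Qed.

Lemma hpell_step m : hpell (m + 2) = 2 * hpell (m + 1) + hpell m.
Proof. apply rec_seq_step. Qed.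

Lemma pell_init : pell 0 = 0 /\ pell 1 = 1 /\ pell (-1) = 1.
Proof. repeat split. Qed.

Lemma hpell_init : hpell 0 = 1 /\ hpell 1 = 1 /\ hpell (-1) = -1.
Proof. repeat split. Qed.

Definition Snk (n k : Z) : R :=
  (((sqrt (IZR n ^ 2 - 1) + 1) * IZR (pell (2 * k + 1))
      + IZR n * IZR (hpell (2 * k + 1)))
   / ((sqrt (IZR n ^ 2 - 1) + 1) * IZR (pell (2 * k - 1))
      + IZR n * IZR (hpell (2 * k - 1))))%R.

(* Main.v *)
(** Dividing by [n], [S_{n,k}] is the value at [r_n = (sqrt (n^2 - 1) + 1) / n]
    of a Moebius map in [r]; in terms of [p = P_{2k}] and [q = P_{2k+1}] it reads
    [(r q + (q + p)) / (r (q - 2 p) + (3 p - q))], and all its relevant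
    determinants are constants because [q^2 - 2 p q - p^2 = 1].  The map is
    decreasing in [r] (determinant [-2]), equals [P_{2k+2} / P_{2k}] at [r = 1] and
    [P_{2k+4} / P_{2k+2}] at [r = 7/5].  So for [k >= 1] the claim is
    [1 < r_{n+1} < r_n < 7/5], where the strict decrease of [r_n] starts at
    [n = 2]. *)

Require Import Defs.
From Stdlib Require Import ZArith Reals Lia Lra Psatz.

(** Both sides solve the same second-order recurrence, so agreement on one consecutive pair
    propagates up and down. The induction hence carries pairs, starting at [j] and at [- j] at
    once. *)
Lemma hpell_eq_pell_diff (m : Z) : hpell m = pell (m + 1) - pell m.
Proof.
  enough (H : forall j, 0 <= j ->
    (hpell j = pell (j + 1) - pell j /\
     hpell (j + 1) = pell (j + 2) - pell (j + 1)) /\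
    (hpell (- j) = pell (- j + 1) - pell (- j) /\
     hpell (- j + 1) = pell (- j + 2) - pell (- j + 1))).
  { destruct (Z.le_gt_cases 0 m) as [Hm|Hm].
    - exact (proj1 (proj1 (H m Hm))).
    - pose proof (proj1 (proj2 (H (- m) ltac:(lia)))) as E.
      rewrite Z.opp_involutive in E; exact E. }
  apply natlike_ind; [repeat split|].
  intros j Hj [[A B] [C D]].
  pose proof (hpell_step j) as Hh. pose proof (pell_step j) as P1.
  pose proof (pell_step (j + 1)) as P2.
  pose proof (hpell_step (- j - 1)) as Gh. pose proof (pell_step (- j - 1)) as Q1.
  pose proof (pell_step (- j)) as Q2.
  replace (Z.succ j) with (j + 1) by lia.
  replace (- (j + 1)) with (- j - 1) by lia.
  replace (j + 1 + 1) with (j + 2) in * by lia.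
  replace (j + 1 + 2) with (j + 3) in * by lia.
  replace (- j - 1 + 1) with (- j) in * by lia.
  replace (- j - 1 + 2) with (- j + 1) in * by lia.
  repeat split; lia.
Qed.

(** The form [q^2 - 2 p q - p^2] is invariant under the double shift sending [(p, q)] to
    [(2 q + p, 5 q + 2 p)], and equals 1 at [(0, 1)]. *)
Lemma pell_even_odd_norm (k : Z) : 0 <= k ->
  pell (2 * k + 1) * pell (2 * k + 1) - 2 * pell (2 * k) * pell (2 * k + 1)
    - pell (2 * k) * pell (2 * k) = 1.
Proof.
  revert k; apply natlike_ind; [reflexivity|].
  intros k Hk IH.
  replace (2 * Z.succ k + 1) with (2 * k + 1 + 2) by lia.
  replace (2 * Z.succ k) with (2 * k + 2) by lia.
  pose proof (pell_step (2 * k)) as P1. pose proof (pell_step (2 * k + 1)) as P2.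
  replace (2 * k + 1 + 1) with (2 * k + 2) in P2 by lia.
  rewrite P2, P1. nia.
Qed.

Lemma pell_pos (m : Z) : 1 <= m -> 0 < pell m.
Proof.
  intros Hm.
  enough (H : forall j, 0 <= j -> 0 < pell (j + 1) /\ 0 < pell (j + 2)).
  { replace m with (m - 1 + 1) by lia. apply H; lia. }
  apply natlike_ind; [split; reflexivity|].
  intros j Hj [A B]. pose proof (pell_step (j + 1)) as P.
  replace (j + 1 + 1) with (j + 2) in P by lia.
  replace (Z.succ j + 1) with (j + 2) by lia.
  replace (Z.succ j + 2) with (j + 1 + 2) by lia.
  lia.
Qed.

Open Scope R_scope.

(** The Moebius map at [r = a / n], kept homogeneous in [(a, n)] to avoid an inner division. *)
Definition moebius (p q a n : R) : R :=
  (a * q + n * (q + p)) / (a * (q - 2 * p) + n * (3 * p - q)).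

Lemma Snk_moebius (n k : Z) :
  Snk n k = moebius (IZR (pell (2 * k))) (IZR (pell (2 * k + 1)))
              (sqrt (IZR n ^ 2 - 1) + 1) (IZR n).
Proof.
  unfold Snk, moebius. rewrite !hpell_eq_pell_diff, !minus_IZR.
  pose proof (pell_step (2 * k)) as P1. pose proof (pell_step (2 * k - 1)) as P0.
  replace (2 * k + 1 + 1)%Z with (2 * k + 2)%Z by lia.
  replace (2 * k - 1 + 1)%Z with (2 * k)%Z in * by lia.
  replace (2 * k - 1 + 2)%Z with (2 * k + 1)%Z in P0 by lia.
  assert (E : pell (2 * k - 1) = (pell (2 * k + 1) - 2 * pell (2 * k))%Z) by lia.
  rewrite P1, E, plus_IZR, minus_IZR, !mult_IZR.
  f_equal; ring.
Qed.

Lemma Rdiv_lt_cross (a b c d : R) : 0 < b -> 0 < d -> a * d < c * b -> a / b < c / d.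
Proof.
  intros Hb Hd H.
  apply (Rmult_lt_reg_r (b * d)); [nra|].
  replace (a / b * (b * d)) with (a * d) by (field; lra).
  replace (c / d * (b * d)) with (c * b) by (field; lra).
  exact H.
Qed.

Section MoebiusBounds.

Context (p q : R) (Hp : 0 < p) (Hq : 0 < q - 2 * p)
  (Hpq : q * q - 2 * p * q - p * p = 1).

(** The denominator regroups as [(a - n) * (q - 2 * p) + n * p]. *)
Lemma moebius_den_pos a n : 0 < n -> n < a ->
  0 < a * (q - 2 * p) + n * (3 * p - q).
Proof. intros; nra. Qed.

Lemma moebius_decreasing a n a' n' : 0 < n -> n < a -> 0 < n' -> n' < a' ->
  a' * n < a * n' -> moebius p q a n < moebius p q a' n'.
Proof.
  intros Hn Ha Hn' Ha' H. unfold moebius.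
  apply Rdiv_lt_cross; try (apply moebius_den_pos; assumption).
  enough ((a * q + n * (q + p)) * (a' * (q - 2 * p) + n' * (3 * p - q))
      - (a' * q + n' * (q + p)) * (a * (q - 2 * p) + n * (3 * p - q))
      = - 2 * (a * n' - a' * n) * (q * q - 2 * p * q - p * p)) as E
    by (rewrite Hpq in E; lra).
  ring.
Qed.

Lemma moebius_upper a n : 0 < n -> n < a -> moebius p q a n < (2 * q + p) / p.
Proof.
  intros Hn Ha. unfold moebius.
  apply Rdiv_lt_cross; [apply moebius_den_pos; assumption|assumption|].
  enough ((a * q + n * (q + p)) * p
      - (2 * q + p) * (a * (q - 2 * p) + n * (3 * p - q))
      = - 2 * (a - n) * (q * q - 2 * p * q - p * p)) as E
    by (rewrite Hpq in E; lra).
  ring.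
Qed.

Lemma moebius_lower a n : 0 < n -> n < a -> 5 * a < 7 * n ->
  (12 * q + 5 * p) / (2 * q + p) < moebius p q a n.
Proof.
  intros Hn Ha H. unfold moebius.
  apply Rdiv_lt_cross; [lra|apply moebius_den_pos; assumption|].
  enough ((12 * q + 5 * p) * (a * (q - 2 * p) + n * (3 * p - q))
      - (a * q + n * (q + p)) * (2 * q + p)
      = (10 * a - 14 * n) * (q * q - 2 * p * q - p * p)) as E
    by (rewrite Hpq in E; lra).
  ring.
Qed.

End MoebiusBounds.

Lemma sqrt_sq_sub1_bounds x : 2 <= x -> x - 1 < sqrt (x ^ 2 - 1) < x.
Proof.
  intros Hx. pose proof (sqrt_pos (x ^ 2 - 1)).
  pose proof (sqrt_sqrt (x ^ 2 - 1) ltac:(nra)).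
  split; nra.
Qed.

(** Isolating the root and squaring leaves [2 * (3 * x - 5) * (4 * x - 5) > 0]. *)
Lemma ratio_lt_seven_fifths x : 2 <= x -> 5 * (sqrt (x ^ 2 - 1) + 1) < 7 * x.
Proof.
  intros Hx. pose proof (sqrt_sq_sub1_bounds x Hx).
  pose proof (sqrt_sqrt (x ^ 2 - 1) ltac:(nra)).
  nra.
Qed.

Lemma ratio_decreasing x : 2 <= x ->
  (sqrt ((x + 1) ^ 2 - 1) + 1) * x < (sqrt (x ^ 2 - 1) + 1) * (x + 1).
Proof.
  intros Hx. pose proof (sqrt_sq_sub1_bounds x Hx) as B.
  pose proof (sqrt_sq_sub1_bounds (x + 1) ltac:(lra)) as B'.
  pose proof (sqrt_sqrt (x ^ 2 - 1) ltac:(nra)) as E.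
  pose proof (sqrt_sqrt ((x + 1) ^ 2 - 1) ltac:(nra)) as E'.
  set (s := sqrt (x ^ 2 - 1)) in *. set (t := sqrt ((x + 1) ^ 2 - 1)) in *.
  enough (t * x < s * (x + 1) + 1) by lra.
  (* The squares differ by [2 * (s * (x + 1) - x)], which is positive because [s > x - 1 >= 1]. *)
  apply Rsqr_incrst_0; [|nra|nra]. unfold Rsqr.
  replace (t * x * (t * x)) with (t * t * (x * x)) by ring.
  replace ((s * (x + 1) + 1) * (s * (x + 1) + 1))
    with (s * s * ((x + 1) * (x + 1)) + 2 * (s * (x + 1)) + 1) by ring.
  rewrite E, E'. nra.
Qed.

Lemma Snk_0_bounds (n : Z) : (2 <= n)%Z ->
  2 * IZR n + 2 < Snk n 0 < 2 * IZR n + 2 + 1 / (2 * IZR n - 2).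
Proof.
  intros Hn%IZR_le. rewrite Snk_moebius. unfold moebius.
  change (pell (2 * 0)) with 0%Z. change (pell (2 * 0 + 1)) with 1%Z.
  set (x := IZR n) in *.
  pose proof (sqrt_sq_sub1_bounds x Hn) as B.
  pose proof (sqrt_sqrt (x ^ 2 - 1) ltac:(nra)) as E.
  set (s := sqrt (x ^ 2 - 1)) in *.
  (* Here [p = 0], so the bounds above do not apply. The denominator [s - (x - 1)] is rationalized
     by [s^2 - (x - 1)^2 = 2 * (x - 1)]. *)
  assert (R : ((s + 1) * 1 + x * (1 + 0)) / ((s + 1) * (1 - 2 * 0) + x * (3 * 0 - 1))
              = 1 + x * (s + x - 1) / (x - 1)).
  { assert (s * s = x * x - 1) by lra.
    field_simplify_eq; [nra|split; lra]. }
  rewrite R. split.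
  (* Once cleared of denominators, this is [s * s = x^2 - 1 < x * s]. *)
  - enough (2 * x + 1 < x * (s + x - 1) / (x - 1)) by lra.
    replace (2 * x + 1) with ((2 * x + 1) / 1) by field.
    apply Rdiv_lt_cross; nra.
  - enough (x * (s + x - 1) / (x - 1)
            < ((2 * x + 1) * (2 * x - 2) + 1) / (2 * x - 2)) as H.
    { replace (((2 * x + 1) * (2 * x - 2) + 1) / (2 * x - 2))
        with (2 * x + 1 + 1 / (2 * x - 2)) in H by (field; lra). lra. }
    (* This is the upper bound cleared of denominators; the squares of its two sides differ by
       exactly 1. *)
    assert (2 * x * s < 2 * (x * x) - 1).
    { apply Rsqr_incrst_0; [|nra|nra]. unfold Rsqr.
      replace (2 * x * s * (2 * x * s)) with (4 * (x * x) * (s * s)) by ring.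
      rewrite E. nra. }
    apply Rdiv_lt_cross; nra.
Qed.

Theorem proposition4p13 :
  (forall n : Z, (2 <= n)%Z ->
     (2 * IZR n + 2 < Snk n 0 < 2 * IZR n + 2 + 1 / (2 * IZR n - 2))%R) /\
  (forall n k : Z, (2 <= n)%Z -> (1 <= k)%Z ->
     (IZR (pell (2 * k + 4)) / IZR (pell (2 * k + 2)) < Snk n k)%R /\
     (Snk n k < Snk (n + 1) k)%R /\
     (Snk (n + 1) k < IZR (pell (2 * k + 2)) / IZR (pell (2 * k)))%R).
Proof.
  split; [exact Snk_0_bounds|].
  intros n k Hn%IZR_le Hk.
  rewrite !Snk_moebius, plus_IZR.
  pose proof (pell_step (2 * k - 1)) as P0. pose proof (pell_step (2 * k)) as P1.
  pose proof (pell_step (2 * k + 1)) as P2. pose proof (pell_step (2 * k + 2)) as P3.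
  replace (2 * k - 1 + 1)%Z with (2 * k)%Z in P0 by lia.
  replace (2 * k - 1 + 2)%Z with (2 * k + 1)%Z in P0 by lia.
  replace (2 * k + 1 + 1)%Z with (2 * k + 2)%Z in P2 by lia.
  replace (2 * k + 1 + 2)%Z with (2 * k + 3)%Z in P2 by lia.
  replace (2 * k + 2 + 1)%Z with (2 * k + 3)%Z in P3 by lia.
  replace (2 * k + 2 + 2)%Z with (2 * k + 4)%Z in P3 by lia.
  pose proof (pell_pos (2 * k) ltac:(lia)) as Hp.
  (* Since [q - 2 * p] is [pell (2 * k - 1)], its positivity comes from [k >= 1]. *)
  pose proof (pell_pos (2 * k - 1) ltac:(lia)) as Hq.
  pose proof (pell_even_odd_norm k ltac:(lia)) as N.
  replace (pell (2 * k + 4)) with (12 * pell (2 * k + 1) + 5 * pell (2 * k))%Z by lia.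
  replace (pell (2 * k + 2)) with (2 * pell (2 * k + 1) + pell (2 * k))%Z by lia.
  assert (Hpq : (0 < pell (2 * k + 1) - 2 * pell (2 * k))%Z) by lia.
  apply IZR_lt in Hp, Hpq. apply (f_equal IZR) in N.
  rewrite !minus_IZR, !mult_IZR in N. rewrite minus_IZR, mult_IZR in Hpq.
  rewrite !plus_IZR, !mult_IZR.
  (* The lower bounds on the roots give [n < a], that is [r > 1], for [n] and for [n + 1]. *)
  pose proof (sqrt_sq_sub1_bounds (IZR n) Hn).
  pose proof (sqrt_sq_sub1_bounds (IZR n + 1) ltac:(lra)).
  repeat split.
  - apply moebius_lower; try lra. apply ratio_lt_seven_fifths; lra.
  - apply moebius_decreasing; try lra. apply ratio_decreasing; lra.
  - apply moebius_upper; lra.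
Qed.
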